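(* There exist $0<\epsilon<1$ and a constant $C=C(\epsilon)>0$ such that the following holds for every integer $n\ge 1$ and every prime $p$. Let $C_p$ and $C_{p^n}$ be the cyclic groups of order $p$ and $p^n$ respectively, and let $\Gamma$ be any extension of (the additive group of) the group algebra $\mathbb F_p[C_p]$ by $C_{p^n}$, where $C_{p^n}$ acts on $\mathbb F_p[C_p]$ by left translation (mod $p$). Then $$g_\epsilon(\Gamma)\le C\, n\log p .$$
   Context: The action of $C_{p^n}$ on $\mathbb F_p[C_p]$ by left translation mod $p$ is the one obtained by composing the quotient map $C_{p^n}\to C_p$ with the left translation action of $C_p$ on $\mathbb F_p[C_p]$. An extension of $A$ by $H$ is a group $\Gamma$ with $A\lhd \Gamma$ and $\Gamma/A\cong H$, such that conjugation induces the given action of $H$ on the abelian group $A$. For a finite group $G$ and a finite generating multiset $T$ of $G$, a number $\epsilon>0$ is an average Kazhdan constant of $G$ with respect to $T$ if $$\inf_{\rho\in G_0^*}\ \inf_{0\neq v\in\mathcal H_\rho}\ \frac{1}{|T|}\sum_{t\in T}\frac{\|\rho(t)v-v\|^2}{\|v\|^2}\ \ge\ \epsilon,$$ where $G_0^*$ denotes the space of unitary representations $(\rho,\mathcal H_\rho)$ of $G$ with no non-zero invariant vectors (sums over $T$ and $|T|$ count multiplicity). For $0<\epsilon<1$, $g_\epsilon(G)$ is the minimal integer $N$ such that there is a generating (multi)set $T$ of $G$ with $|T|\le N$ for which $G$ has average Kazhdan constant with respect to $T$ greater than or equal to $\epsilon$. *)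

(* Defs.v *)
From HB Require Import structures.
From mathcomp Require Import all_boot all_order all_algebra all_fingroup.
From mathcomp Require Import complex.
From mathcomp Require Import all_classical all_reals all_analysis.

Set Implicit Arguments.
Unset Strict Implicit.
Unset Printing Implicit Defensive.

Import Order.TTheory GRing.Theory Num.Theory Num.Def.
Import numFieldNormedType.Exports.

Local Open Scope classical_set_scope.
Local Open Scope ring_scope.

(* The Hilbert space is a complete normed space over [R[i]] whose norm comes
   from an inner product; its dimension is unrestricted.  The values of
   [ur_act] outside of [G] are irrelevant. *)
Record unitary_rep (R : realType) (gT : finGroupType) (G : {group gT}) := {
  ur_space : completeNormedModType R[i] ;
  ur_dot : {dot ur_space for conjC} ;
  ur_normE : forall v, `|v| ^+ 2 = ur_dot v v ;
  ur_act : gT -> {linear ur_space -> ur_space} ;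
  ur_act1 : forall v, ur_act 1%g v = v ;
  ur_actM : {in G &, forall g h v, ur_act (g * h)%g v = ur_act g (ur_act h v)} ;
  ur_actU : {in G, forall g u v,
               ur_dot (ur_act g u) (ur_act g v) = ur_dot u v} }.

Definition no_invariant_vector (R : realType) (gT : finGroupType)
    (G : {group gT}) (rho : unitary_rep R G) : Prop :=
  forall v : ur_space rho, {in G, forall g, ur_act rho g v = v} -> v = 0.

(* The norms below are elements of [R[i]] with zero imaginary part. *)
Definition avg_displacement (R : realType) (gT : finGroupType)
    (G : {group gT}) (rho : unitary_rep R G) (T : seq gT)
    (v : ur_space rho) : R :=
  complex.Re ((size T)%:R^-1 *
    \sum_(t <- T) (`|ur_act rho t v - v| ^+ 2 / `|v| ^+ 2)).

(* Both infima are taken in the extended reals, so that an empty one is +oo.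
   The outer set is spelled out with [exists2], as [unitary_rep R G] lives in
   too large a universe for [set (unitary_rep R G)]. *)
Definition avg_kazhdan_inf (R : realType) (gT : finGroupType)
    (G : {group gT}) (T : seq gT) : \bar R :=
  ereal_inf [set x : \bar R |
    exists2 rho : unitary_rep R G, no_invariant_vector rho &
      x = ereal_inf [set (avg_displacement T v)%:E
                    | v in [set v : ur_space rho | v != 0]]].

Definition is_avg_kazhdan (R : realType) (eps : R) (gT : finGroupType)
    (G : {group gT}) (T : seq gT) : Prop :=
  (eps%:E <= avg_kazhdan_inf R G T)%E.

(* Finite multisets of elements are lists; the order is immaterial. *)
Definition g_attained (R : realType) (eps : R) (gT : finGroupType)
    (G : {group gT}) (N : nat) : Prop :=
  exists T : seq gT,
    [/\ <<[set x in T]%SET>>%g = G, (size T <= N)%N & is_avg_kazhdan eps G T].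

(* [g_eps(G) = N] *)
Definition is_g (R : realType) (eps : R) (gT : finGroupType)
    (G : {group gT}) (N : nat) : Prop :=
  g_attained eps G N /\ forall M, g_attained eps G M -> (N <= M)%N.

(* [G] is an extension of [aT] by [hT], with kernel [A], in which conjugation
   [a |-> x a x^-1] induces the given left action [act] of [hT] on [aT]. *)
Definition is_extension (aT hT gT : finGroupType) (act : hT -> aT -> aT)
    (G : {group gT}) : Prop :=
  exists (A : {group gT}) (iota : aT -> gT) (pi : coset_of A -> hT),
    [/\ normal A G,
        misom [set: aT]%SET A iota,
        misom (G / A)%g [set: hT]%SET pi &
        {in G, forall x a, ((iota a) ^ (x^-1))%g = iota (act (pi (coset A x)) a)}].

(* The group algebra [K[C]]: [f] stands for the sum of the [f x * x]. *)
Definition group_alg (K : finFieldType) (C : finGroupType) := {ffun C -> K}.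
HB.instance Definition _ (K : finFieldType) (C : finGroupType) :=
  GRing.Zmodule.on (group_alg K C).
HB.instance Definition _ (K : finFieldType) (C : finGroupType) :=
  Finite.on (group_alg K C).
HB.instance Definition _ (K : finFieldType) (C : finGroupType) :=
  [finGroupMixin of group_alg K C for +%R].

(* Left translation by [c], which sends the basis vector [x] to [c * x]. *)
Definition ltrans (K : finFieldType) (C : finGroupType) (c : C)
    (f : group_alg K C) : group_alg K C :=
  [ffun x => f (c^-1 * x)%g].

(* [inZp] is the quotient map from [C_{p^n}] to [C_p] when [p] is prime and
   [0 < n]; the group laws on ['Z_(p ^ n)] and ['Z_p] are the additions. *)
Definition ltrans_modp (p n : nat) (c : 'Z_(p ^ n))
    (f : group_alg 'F_p 'Z_p) : group_alg 'F_p 'Z_p :=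
  ltrans (inZp c : 'Z_p) f.

(* Main.v *)
Require Import Defs.
From mathcomp Require Import all_boot all_order all_algebra all_fingroup.
From mathcomp Require Import all_field complex.
From mathcomp Require Import all_classical all_reals all_analysis.
From mathcomp Require Import ring lra zify.

Set Implicit Arguments.
Unset Strict Implicit.
Unset Printing Implicit Defensive.

Import Order.TTheory GRing.Theory Num.Theory Num.Def.

Local Open Scope ring_scope.

(** Let [A] be the group algebra of [C_p] over [F_p], [c] a lift of the
    generator of [C_{p^n}] and [N = p^(n+1)], so that [c^N = 1].  Greedy
    derandomization of the Alon-Roichman argument gives a multiset [s] of
    [O(log N)] exponents such that every [N]-th root of unity [z <> 1] satisfies
    [|z^k - 1| >= 1] for a constant proportion of the [k] in [s].  The generating
    multiset consists of the powers [g^k], [k] in [s], of just three elements [g]: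
    [c] and two elements [u_0], [u_h] of [A], with [h = p/2].

    If [v] is moved little by the powers of [c], it is close to a [c]-invariant
    vector [w].  The spectral measure of [w] on the dual of [A] (again functions
    on [Z/p]) is invariant under translation and vanishes at [0], so it suffices
    that for every [f <> 0] at least [p/2] of the [p] translates of [f] pair
    nontrivially with [u_0], or with [u_h].  View [f] as
    the polynomial of degree [< p] interpolating it, and let [u_h] extract the
    [h]-th coefficient: the pairings are then the values of the [0]-th and
    [h]-th Hasse derivatives of that polynomial, one of which is nonzero of
    degree at most [p/2] and hence has at most [p/2] zeros. *)

(** * Derandomized sampling *)

Section Sampling.
Variables (J K : finType) (good : J -> K -> bool).

Let weight (s : seq K) (j : J) : nat :=
  \prod_(k <- s) (if good j k then 1 else 4)%N.

Lemma weightE s j : weight s j = (4 ^ (size s - count (good j) s))%N.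
Proof.
rewrite /weight; elim: s => [|k s IH]; first by rewrite big_nil.
rewrite big_cons IH /=; case: (good j k) => /=; first by rewrite mul1n add1n subSS.
by rewrite add0n subSn ?count_size // expnS.
Qed.

(** Averaging over [k]: at least a third of the new factors are 1 and the others are 4, so for each
    [j] they add up to at most [3 * #|K|], and some [k] does no worse than the mean. *)
Lemma potential_step (Q : pred J) s :
  (forall j, Q j -> #|K| <= 3 * #|[set k | good j k]|)%N -> (0 < #|K|)%N ->
  exists k, (\sum_(j | Q j) weight (k :: s) j <= 3 * \sum_(j | Q j) weight s j)%N.
Proof.
move=> third K0.
have arith (c g g' : nat) :
  (c <= 3 * g -> c = g + g' -> g * 1 + g' * 4 <= c * 3)%N by lia.
have tot : (\sum_(k : K) \sum_(j | Q j) weight (k :: s) j <=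
            #|K| * (3 * \sum_(j | Q j) weight s j))%N.
  rewrite exchange_big /= mulnA big_distrr /=; apply: leq_sum => j Qj.
  under eq_bigr do rewrite /weight big_cons -/(weight s j).
  rewrite -big_distrl /= leq_mul2r; apply/orP; right.
  rewrite (bigID (good j)) /=.
  rewrite (eq_bigr (fun=> 1%N)) => [|k ->] //.
  rewrite [X in (_ + X <= _)%N](eq_bigr (fun=> 4%N)) => [|k /negbTE->] //.
  rewrite !sum_nat_const.
  have := cardsC [set k | good j k]; have := third j Qj.
  have -> : #|[pred k | ~~ good j k]| = #|~: [set k | good j k]|.
    by apply: eq_card => k; rewrite !inE.
  have -> : #|[pred k | good j k]| = #|[set k | good j k]|.
    by apply: eq_card => k; rewrite !inE.
  by move=> + /esym; apply: arith.
apply/existsP; apply: contraT; rewrite negb_exists => /forallP H.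
suff : (#|K| * (3 * \sum_(j | Q j) weight s j) <
        \sum_(k : K) \sum_(j | Q j) weight (k :: s) j)%N by rewrite ltnNge tot.
rewrite -sum_nat_const.
have [k0 _] : exists k0 : K, k0 \in K by have /card_gt0P := K0.
rewrite (bigD1 k0) //= [X in (_ < X)%N](bigD1 k0) //= -addSn leq_add //.
  by rewrite ltnNge H.
by apply: leq_sum => k _; rewrite leqNgt -ltnNge ltnW // ltnNge H.
Qed.

(* Method of conditional expectations: a random element multiplies the total
   weight [\sum_j 4 ^ (size s - hits j)] by at most [3] on average. *)
Lemma exists_sampling (Q : pred J) (L : nat) :
  (forall j, Q j -> #|K| <= 3 * #|[set k | good j k]|)%N -> (0 < #|K|)%N ->
  (#|J| <= 2 ^ L)%N ->
  exists2 s : seq K, size s = (8 * L)%N &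
    forall j, Q j -> (L <= count (good j) s)%N.
Proof.
move=> third K0 JL.
have [s ss pot] : exists2 s : seq K, size s = (8 * L)%N &
    (\sum_(j | Q j) weight s j <= 3 ^ (8 * L) * #|J|)%N.
  elim: (8 * L)%N => [|m [s ss pot]].
    exists [::] => //; rewrite expn0 mul1n -sum1_card.
    under eq_bigr do rewrite /weight big_nil.
    by rewrite [X in (_ <= X)%N](bigID Q) /= leq_addr.
  have [k Hk] := potential_step s third K0.
  exists (k :: s); rewrite /= ?ss //; apply: (leq_trans Hk).
  by rewrite expnS -mulnA leq_mul2l.
exists s => // j Qj; rewrite leqNgt; apply/negP => few.
have : (weight s j <= 3 ^ (8 * L) * 2 ^ L)%N.
  apply: leq_trans (leq_trans pot _); last by rewrite leq_mul2l JL orbT.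
  by rewrite (bigD1 j) //= leq_addr.
rewrite weightE ss => le1.
(* Fewer than [L] hits leave at least [7 * L + 1] misses. This is too heavy because
   [3 ^ 8 * 2 = 13122] is below [4 ^ 7 = 16384]. *)
have le2 : (4 ^ (7 * L).+1 <= 4 ^ (8 * L - count (good j) s))%N.
  by rewrite leq_exp2l //; lia.
have := leq_trans le2 le1.
rewrite expnS !expnM -expnMn leqNgt => /negP; apply.
have : (((3 ^ 8) * 2) ^ L <= (4 ^ 7) ^ L)%N by rewrite leq_exp2r ?(leq_trans _ few).
have : (0 < (4 ^ 7) ^ L)%N by rewrite expn_gt0.
move: ((4 ^ 7) ^ L)%N (((3 ^ 8) * 2) ^ L)%N => a b; lia.
Qed.

End Sampling.

(** * Unitary characters of a finite group *)

Section Character.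
Variables (C : numClosedFieldType) (A : finGroupType) (chi : A -> C).
Hypothesis chiM : {morph chi : a b / (a * b)%g >-> a * b}.
Hypothesis chi_norm : forall a, `|chi a| = 1.

Lemma chi_neq0 a : chi a != 0.
Proof. by rewrite -normr_gt0 chi_norm. Qed.

Lemma chi1 : chi 1%g = 1.
Proof. by apply: (mulfI (chi_neq0 1)); rewrite -chiM mulg1 mulr1. Qed.

Lemma chiV a : chi a^-1%g = (chi a)^*.
Proof.
apply: (mulfI (chi_neq0 a)).
by rewrite -chiM mulgV chi1 -normCK chi_norm expr1n.
Qed.

Lemma sum_chi_eq0 b : chi b != 1 -> \sum_a chi a = 0.
Proof.
move=> bn1; apply/eqP; have: (chi b - 1) * \sum_a chi a = 0.
  rewrite mulrBl mul1r big_distrr /= [X in _ - X](reindex_inj (mulgI b)) /=.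
  by apply/eqP; rewrite subr_eq0; apply/eqP/eq_bigr => a _; rewrite chiM.
by move/eqP; rewrite mulf_eq0 subr_eq0 (negbTE bn1).
Qed.

Lemma sqr_chi_sub1 a : `|chi a - 1| ^+ 2 = 2%:R - chi a - chi a^-1%g.
Proof.
rewrite normCK rmorphB rmorph1 /= -chiV; have := chiM a a^-1%g.
by rewrite mulgV chi1 => e; rewrite mulrBl mulrBr -e; ring.
Qed.

(** The squared displacement has mean 2 by [sum_chi_eq0] and never exceeds 4. If it is at least 1 on
    a proportion [t] of [A], then [2 <= 1 + 3 * t]. *)
Lemma card_le3_chi_displaced b : chi b != 1 ->
  (#|A| <= 3 * #|[set a | (1 <= `|chi a - 1| ^+ 2)%R]|)%N.
Proof.
move=> bn1; rewrite -(ler_nat C).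
have tot : \sum_a `|chi a - 1| ^+ 2 = 2 * #|A|%:R.
  under eq_bigr do rewrite sqr_chi_sub1.
  rewrite !sumrB [X in _ - X](reindex_inj invg_inj) /=.
  under [X in _ - X]eq_bigr do rewrite invgK.
  by rewrite (sum_chi_eq0 bn1) !subr0 sumr_const -[LHS]mulr_natr cardT -cardT.
have up : \sum_a `|chi a - 1| ^+ 2 <=
          \sum_a (1 + (1 <= `|chi a - 1| ^+ 2)%R%:R * 3).
  apply: ler_sum => a _; case: (boolP (1 <= `|chi a - 1| ^+ 2)) => h /=.
    rewrite mul1r -natr1 (_ : 1 + (2 + 1) = 2 ^+ 2 :> C); last by ring.
    rewrite lerXn2r ?nnegrE //; apply: le_trans (ler_normB _ _) _.
    by rewrite chi_norm normr1.
  by rewrite mul0r addr0 ltW // real_ltNge ?ger0_real ?exprn_ge0 ?ler01.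
move: up; rewrite tot big_split /= -big_distrl /= sumr_const.
rewrite -natr_sum (_ : 2 = 1 + 1 :> C) // mulrDl mul1r lerD2l.
move/le_trans; apply; rewrite -natrM ler_nat mulnC leq_mul2l.
rewrite (eq_bigr (fun a => if a \in [set a | (1 <= `|chi a - 1| ^+ 2)%R] then 1 else 0)%N).
  by rewrite -big_mkcond sum1_card leqnn orbT.
by move=> a _; rewrite inE; case: (_ <= _).
Qed.
End Character.

(** * Spectral decomposition over a finite group [A] whose dual is indexed by [F] *)

Section Spectral.
Variables (C : numClosedFieldType) (U : lmodType C) (dot : {dot U for conjC}).
Variables (A : finGroupType) (F : finType) (chi : F -> A -> C).
Variable r : A -> {linear U -> U}.

(** Under the hypotheses below, this is the orthogonal projection onto the vectors on which [r] acts
    through the character [chi f]. *)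
Definition isotypic f v := #|A|%:R^-1 *: \sum_a (chi f a)^* *: r a v.

Lemma isotypicB f u v : isotypic f (u - v) = isotypic f u - isotypic f v.
Proof.
rewrite /isotypic -scalerBr -sumrB; congr (_ *: _).
by apply: eq_bigr => a _; rewrite linearB scalerBr.
Qed.

Hypothesis chiM : forall f, {morph chi f : a b / (a * b)%g >-> a * b}.
Hypothesis chi_norm : forall f a, `|chi f a| = 1.
Hypothesis chi_sum : forall a, \sum_f chi f a = (a == 1%g)%:R * #|A|%:R.
Hypothesis chi_sep : forall f f', f != f' -> exists a, chi f a != chi f' a.
Hypothesis r1 : forall v, r 1%g v = v.
Hypothesis rM : forall a b v, r (a * b)%g v = r a (r b v).
Hypothesis rU : forall a u v, dot (r a u) (r a v) = dot u v.

Lemma sum_isotypic v : \sum_f isotypic f v = v.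
Proof.
rewrite /isotypic -scaler_sumr exchange_big /=.
under eq_bigr do rewrite -scaler_suml -rmorph_sum chi_sum.
rewrite (bigD1 1%g) //= big1 ?addr0; last first.
  by move=> a /negbTE->; rewrite mul0r rmorph0 scale0r.
rewrite eqxx mul1r rmorph_nat r1 scalerA mulVf ?scale1r //.
by rewrite pnatr_eq0 -lt0n; apply/card_gt0P; exists 1%g.
Qed.

Lemma act_isotypic f b v : r b (isotypic f v) = chi f b *: isotypic f v.
Proof.
rewrite /isotypic linearZ linear_sum /= [RHS]scalerA mulrC -scalerA; congr (_ *: _).
rewrite scaler_sumr [RHS](reindex_inj (mulgI b)) /=; apply: eq_bigr => a _.
rewrite linearZ /= -rM scalerA; congr (_ *: _).
by rewrite chiM rmorphM mulrA -normCK chi_norm expr1n mul1r.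
Qed.

(** Some unitary operator [r a] has different eigenvalues on the two components. *)
Lemma isotypic_orth f f' u v :
  f != f' -> dot (isotypic f u) (isotypic f' v) = 0.
Proof.
move/chi_sep => [a neq]; have := rU a (isotypic f u) (isotypic f' v).
rewrite !act_isotypic linearZl_LR linearZr_LR /= mulrA => /eqP.
rewrite -subr_eq0 -{2}[dot _ _]mul1r -mulrBl mulf_eq0 => /orP[|/eqP//].
rewrite subr_eq0 => /eqP e; case/eqP: neq.
rewrite -[LHS]mulr1 -(expr1n _ 2) -(chi_norm f' a) normCK mulrCA e; ring.
Qed.

(** Pythagoras for a spectral multiplier [c]. The multipliers [1], [chi f a - 1] and the indicator
    of [f != f0] give the next three lemmas. *)
Lemma dnorm_sum_isotypic (c : F -> C) v :
  let w := \sum_f c f *: isotypic f v in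
  dot w w = \sum_f `|c f| ^+ 2 * dot (isotypic f v) (isotypic f v).
Proof.
rewrite /= linear_sumlz; apply: eq_bigr => f _.
rewrite linear_sumr (bigD1 f) //= big1 ?addr0; last first.
  by move=> f' nf; rewrite linearZl_LR linearZr_LR /= isotypic_orth ?mulr0 // eq_sym.
by rewrite -dnormZ.
Qed.

Lemma dnorm_isotypic v :
  dot v v = \sum_f dot (isotypic f v) (isotypic f v).
Proof.
have := dnorm_sum_isotypic (fun=> 1) v; rewrite /=.
under eq_bigr do rewrite scale1r.
by rewrite sum_isotypic => ->; apply: eq_bigr => f _; rewrite normr1 expr1n mul1r.
Qed.

Lemma dnorm_displacement a v : dot (r a v - v) (r a v - v) =
  \sum_f `|chi f a - 1| ^+ 2 * dot (isotypic f v) (isotypic f v).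
Proof.
rewrite -dnorm_sum_isotypic; suff -> : r a v - v =
  \sum_f (chi f a - 1) *: isotypic f v by [].
rewrite -{1 2}[v]sum_isotypic linear_sum -sumrB; apply: eq_bigr => f _.
by rewrite /= act_isotypic scalerBl scale1r.
Qed.

Lemma dnorm_sub_isotypic f0 v :
  dot (v - isotypic f0 v) (v - isotypic f0 v) =
  \sum_(f | f != f0) dot (isotypic f v) (isotypic f v).
Proof.
have := dnorm_sum_isotypic (fun f => (f != f0)%:R) v.
rewrite /= (bigD1 f0) //= eqxx scale0r add0r.
under eq_bigr => f ne do rewrite ne scale1r.
rewrite (_ : \sum_(f | _) _ = v - isotypic f0 v) => [->|]; last first.
  by rewrite -[X in X - _]sum_isotypic [in RHS](bigD1 f0) //= addrAC subrr add0r.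
rewrite (bigD1 f0) //= eqxx normr0 expr0n mul0r add0r.
by apply: eq_bigr => f ->; rewrite normr1 expr1n mul1r.
Qed.

(** Every eigenvalue [chi f a] is an [N]-th root of unity, so a single sample [s] handles all
    spectral components at once. *)
Lemma spectral_sample_gap (N L : nat) (s : seq nat) a v :
  (forall w : C, w ^+ N = 1 -> w != 1 ->
     L%:R <= \sum_(k <- s) `|w ^+ k - 1| ^+ 2) ->
  (a ^+ N = 1)%g ->
  L%:R * (\sum_(f | chi f a != 1) dot (isotypic f v) (isotypic f v)) <=
  \sum_(k <- s) dot (r (a ^+ k)%g v - v) (r (a ^+ k)%g v - v).
Proof.
move=> sample aN.
have chiX f k : chi f (a ^+ k)%g = chi f a ^+ k.
  elim: k => [|k IH]; first by rewrite (chi1 (@chiM f) (chi_norm f)).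
  by rewrite expgS chiM IH exprS.
under [X in _ <= X]eq_bigr do rewrite dnorm_displacement.
rewrite exchange_big /= mulr_sumr [X in X <= _]big_mkcond.
apply: ler_sum => f _; rewrite -mulr_suml; case: ifPn => [ne|_].
  rewrite ler_wpM2r ?dnorm_ge0 //; under eq_bigr do rewrite chiX.
  by apply: sample => //; rewrite -chiX aN (chi1 (@chiM f) (chi_norm f)).
by rewrite mulr_ge0 ?dnorm_ge0 // sumr_ge0 // => k _; rewrite exprn_ge0.
Qed.

End Spectral.

(** * Polynomial interpolation and Hasse derivatives over ['F_p] *)

Section Interpolation.
Variable p : nat.
Hypothesis pr_p : prime p.

(** ['F_p] is ['Z_(pdiv p)], a type distinct from ['Z_p]; this map identifies the group elements
    with the points of the coefficient field. *)
Definition Fp_point (x : 'Z_p) : 'F_p := (x : nat)%:R.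

Let p_gt1 : (1 < p)%N := prime_gt1 pr_p.
Let p_char : p \in [pchar 'F_p] := pchar_Fp pr_p.

Lemma natr_mod_char m : (m %% p)%:R = m%:R :> 'F_p.
Proof. by rewrite {2}(divn_eq m p) natrD natrM (pcharf0 p_char) mulr0 add0r. Qed.

Lemma Fp_pointD x y : Fp_point (x + y) = Fp_point x + Fp_point y.
Proof. by rewrite /Fp_point /= -natrD [in X in (_ %% X)%N](Zp_cast p_gt1) natr_mod_char. Qed.

Lemma Fp_point0 : Fp_point 0 = 0. Proof. by []. Qed.

Lemma Fp_pointN x : Fp_point (- x) = - Fp_point x.
Proof. by apply/eqP; rewrite -addr_eq0 -Fp_pointD addNr. Qed.

Lemma Fp_point_inj : injective Fp_point.
Proof.
have ker z : Fp_point z = 0 -> z = 0.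
  move=> /eqP; rewrite /Fp_point -(dvdn_pcharf p_char) => dv; apply/val_inj/eqP => /=.
  apply: contraTT dv => z0; rewrite gtnNdvd ?lt0n //.
  by have := ltn_ord z; rewrite {2}Zp_cast.
move=> x y exy; apply/eqP; rewrite -subr_eq0; apply/eqP/ker.
by rewrite Fp_pointD Fp_pointN exy subrr.
Qed.

Lemma card_Zp_prime : #|'Z_p| = p.
Proof. by rewrite card_ord Zp_cast. Qed.

(** A nonzero polynomial has fewer roots than its size. The sign matches the points where
    [coef_interpolant_ltrans] evaluates. *)
Lemma card_nonroots_gt (q : {poly 'F_p}) : q != 0 ->
  (p < #|[set x : 'Z_p | (q.[- Fp_point x] != 0)%R]| + size q)%N.
Proof.
move=> q0; pose Z := [set x : 'Z_p | root q (- Fp_point x)].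
have := cardsC Z; rewrite card_Zp_prime => {1}<-.
have -> : ~: Z = [set x : 'Z_p | q.[- Fp_point x] != 0].
  by apply/setP => x; rewrite !inE rootE.
rewrite addnC ltn_add2l cardE -(size_map (fun x => - Fp_point x)).
apply: max_poly_roots => //; first by apply/allP => _ /mapP[x + ->]; rewrite mem_enum inE.
by rewrite map_inj_uniq ?enum_uniq // => x y /oppr_inj/Fp_point_inj.
Qed.

(** The Lagrange polynomial at [x] for the whole field, in closed form by Fermat's little
    theorem. *)
Definition lagrange_basis (x : 'Z_p) : {poly 'F_p} :=
  1 - ('X - (Fp_point x)%:P) ^+ p.-1.

Lemma size_lagrange_basis x : (size (lagrange_basis x) <= p)%N.
Proof.
rewrite /lagrange_basis (leq_trans (size_polyD _ _)) // size_polyN size_poly1.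
by rewrite size_exp_XsubC prednK ?prime_gt0 // geq_max prime_gt0 /=.
Qed.

Lemma horner_lagrange_basis x y :
  (lagrange_basis x).[Fp_point y] = (x == y)%:R.
Proof.
rewrite /lagrange_basis !hornerE; have [->|neq] := eqVneq x y.
  by rewrite subrr expr0n -[_ == _]negbK -lt0n -ltnS prednK ?prime_gt0 // p_gt1 subr0.
have nz : Fp_point y - Fp_point x != 0.
  by rewrite subr_eq0 (inj_eq Fp_point_inj) eq_sym.
move: (_ - Fp_point x) nz => z nz; rewrite (_ : z ^+ _ = 1) ?subrr //.
by apply: (mulfI nz); rewrite -exprS prednK ?prime_gt0 // mulr1 -[RHS]expf_card card_Fp.
Qed.

Definition interpolant (f : group_alg 'F_p 'Z_p) : {poly 'F_p} :=
  \sum_x f x *: lagrange_basis x.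

Lemma size_interpolant (f : group_alg 'F_p 'Z_p) : (size (interpolant f) <= p)%N.
Proof.
apply: (leq_trans (size_sum _ _ _)); apply/bigmax_leqP => x _.
exact: leq_trans (size_scale_leq _ _) (size_lagrange_basis x).
Qed.

Lemma horner_interpolant (f : group_alg 'F_p 'Z_p) y : (interpolant f).[Fp_point y] = f y.
Proof.
rewrite horner_sum (bigD1 y) //= hornerZ horner_lagrange_basis eqxx mulr1.
rewrite big1 ?addr0 // => x /negbTE ne.
by rewrite hornerZ horner_lagrange_basis ne mulr0.
Qed.

Lemma interpolant_uniq (f : group_alg 'F_p 'Z_p) (q : {poly 'F_p}) : (size q <= p)%N ->
  (forall y, q.[Fp_point y] = f y) -> q = interpolant f.
Proof.
move=> sq ev; apply/eqP; rewrite -subr_eq0; apply: contraT => /card_nonroots_gt.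
rewrite (_ : [set x | _] = finset.set0) ?cards0 ?add0n => [|].
  rewrite ltnNge (leq_trans (size_polyD _ _)) // geq_max sq size_polyN.
  by rewrite size_interpolant.
apply/setP => x; rewrite !inE -Fp_pointN hornerD hornerN ev horner_interpolant.
by rewrite subrr eqxx.
Qed.

(** If [q] interpolates [f], then [q(X - x)] interpolates the translate, and its Taylor expansion at
    [- x] has the Hasse derivatives of [q] as coefficients. *)
Lemma coef_interpolant_ltrans f (x : 'Z_p) h : (h < p)%N ->
  (interpolant (ltrans x f))`_h = (interpolant f)^`N(h).[- Fp_point x].
Proof.
move=> hp; rewrite -(@interpolant_uniq _ (\poly_(i < p) (interpolant f)^`N(i).[- Fp_point x])).
- by rewrite coef_poly hp.
- exact: size_poly.
move=> y; rewrite horner_poly ffunE -horner_interpolant.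
have -> : (x^-1 * y)%g = - x + y by [].
by rewrite Fp_pointD Fp_pointN (nderiv_taylor_wide (n:=p)) ?size_interpolant //; apply: mulrC.
Qed.

Lemma prime_ndvd_fact n : (n < p)%N -> ~~ (p %| n`!)%N.
Proof.
elim: n => [|n IH] np; first by rewrite dvdn1; case: (p) p_gt1 => [|[]].
by rewrite factS Euclid_dvdM // negb_or IH ?(ltnW np) // gtnNdvd.
Qed.

(** The leading coefficient of [q] gets multiplied by a binomial coefficient whose upper index is
    below [p]; it divides a factorial prime to [p]. *)
Lemma nderivn_neq0 (q : {poly 'F_p}) h : (h < size q <= p)%N ->
  q^`N(h) != 0.
Proof.
case/andP => hq qp; apply/eqP => /polyP/(_ ((size q).-1 - h)%N).
have q0 : (0 < size q)%N by apply: leq_trans hq.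
rewrite coef_nderivn coef0 subnKC; last by rewrite -ltnS prednK.
rewrite -mulr_natr => /eqP; rewrite mulf_eq0 -lead_coefE lead_coef_eq0.
rewrite -size_poly_eq0 eqn0Ngt q0 /= -(dvdn_pcharf p_char) => dv.
suff: (p %| (size q).-1`!)%N by apply/negP/prime_ndvd_fact; rewrite prednK.
by rewrite -(@bin_fact _ h) ?dvdn_mulr // -ltnS prednK.
Qed.

Definition pairing (f u : group_alg 'F_p 'Z_p) : 'F_p := \sum_x f x * u x.

(* Pairing with this element extracts the [h]-th coefficient of the interpolant. *)
Definition coef_elt (h : nat) : group_alg 'F_p 'Z_p :=
  [ffun x => (lagrange_basis x)`_h].

Lemma pairing_coef_elt f h : pairing f (coef_elt h) = (interpolant f)`_h.
Proof.
by rewrite coef_sum; apply: eq_bigr => x _; rewrite ffunE coefZ.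
Qed.

(** The constant coefficient is the value at 0. Thus [coef_elt 0] is the basis vector of the
    identity, and its translates span the group algebra. *)
Lemma coef_elt0 x : coef_elt 0 x = (x == 0)%:R.
Proof. by rewrite ffunE -horner_coef0 -Fp_point0 horner_lagrange_basis. Qed.

(* Either the interpolant has degree below [p / 2], or its [p./2]-th Hasse
   derivative is nonzero of degree below [p / 2]. *)
Lemma pairing_translates f : f != 0 ->
  (p <= 2 * (#|[set x | pairing (ltrans x f) (coef_elt 0) != 0%R]| +
             #|[set x | pairing (ltrans x f) (coef_elt p./2) != 0%R]|))%N.
Proof.
move=> f0; set q := interpolant f.
have q0 : q != 0.
  apply: contraNneq f0 => q0; apply/eqP/ffunP => x.
  by rewrite -horner_interpolant -/q q0 horner0 ffunE.
have setE h : (h < p)%N -> [set x | pairing (ltrans x f) (coef_elt h) != 0] =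
    [set x : 'Z_p | q^`N(h).[- Fp_point x] != 0].
  move=> hp; apply/setP => x.
  by rewrite !inE pairing_coef_elt coef_interpolant_ltrans.
rewrite !setE ?prime_gt0 //; last by lia.
rewrite nderivn0; have [le|lt] := leqP (size q) p./2.
  by have := card_nonroots_gt q0; move: #|_| #|_| => N M; lia.
(* The derivative has size at most [p - p./2], so it has strictly more than [p./2] nonroots;
   strictness absorbs the rounding for odd [p]. *)
have := card_nonroots_gt (@nderivn_neq0 q p./2 _); rewrite lt size_interpolant => /(_ isT).
have : (size q^`N(p./2) <= size q - p./2)%N by apply: size_poly.
have := size_interpolant f; rewrite -/q.
by move: #|_| #|_| (size _^`N(_)) => M N d; lia.
Qed.

End Interpolation.

(** * Roots of unity and spectral samples *)

(** Take a root [y] of [1 + X + ... + X^(p-1)], which is not 1 in characteristic 0, and a [p^k]-th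
    root [z] of [y]. The order of [z] divides [p^(k+1)] but not [p^k]. *)
Lemma exists_prim_root_pfactor (C : numClosedFieldType) p k : prime p ->
  exists z : C, (p ^ k.+1).-primitive_root z.
Proof.
move=> pr_p; have p_gt1 := prime_gt1 pr_p.
have /closed_rootP[y y0] : size (\poly_(i < p) (1 : C)) != 1.
  by rewrite size_poly_eq ?oner_eq0 // neq_ltn p_gt1 orbT.
have {y0} sum0 : \sum_(i < p) y ^+ i = 0.
  move: y0; rewrite rootE horner_poly => /eqP e; rewrite -[RHS]e.
  by apply: eq_bigr => i _; rewrite mul1r.
have yp : y ^+ p = 1 by apply/eqP; rewrite -subr_eq0 subrX1 sum0 mulr0.
have yn1 : y != 1.
  apply/eqP => y1; move/eqP: sum0; rewrite y1.
  under eq_bigr do rewrite expr1n.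
  by rewrite sumr_const card_ord pnatr_eq0 gtn_eqF // ltnW.
have pk0 : (0 < p ^ k)%N by rewrite expn_gt0 ltnW.
have /closed_rootP[z] : size ('X^(p ^ k) - y%:P) != 1.
  by rewrite size_XnsubC // eqSS -lt0n.
rewrite rootE !hornerE subr_eq0 => /eqP zy.
have zN : z ^+ (p ^ k.+1) = 1 by rewrite expnSr exprM zy.
have N0 : (0 < p ^ k.+1)%N by rewrite expn_gt0 ltnW.
have [m prim_z /(dvdn_pfactor _ _ pr_p)[e le_e m_e]] := prim_order_exists N0 zN.
exists z; move: le_e; rewrite leq_eqVlt => /orP[/eqP e_k|lt_e].
  by rewrite -e_k -m_e.
case/eqP: yn1; rewrite -zy; apply/eqP; rewrite -(prim_order_dvd prim_z) m_e.
exact: dvdn_exp2l.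
Qed.

Section ZpCharacter.
Variables (C : numClosedFieldType) (N : nat) (w : C).
Hypotheses (N_gt1 : (1 < N)%N) (wN : w ^+ N = 1).

Definition Zp_char (x : 'Z_N) : C := w ^+ x.

Lemma Zp_char0 : Zp_char 0 = 1. Proof. by []. Qed.

Lemma Zp_charD x y : Zp_char (x + y) = Zp_char x * Zp_char y.
Proof. by rewrite /Zp_char -exprD /= expr_mod // Zp_cast. Qed.

Lemma norm_Zp_char x : `|Zp_char x| = 1.
Proof.
suff w1 : `|w| = 1 by rewrite normrX w1 expr1n.
apply/eqP; rewrite -(@pexpr_eq1 _ _ N) ?normr_ge0 ?(ltnW N_gt1) //.
by rewrite -normrX wN normr1.
Qed.

End ZpCharacter.

Lemma Zp_char_neq1 (C : numClosedFieldType) N (z : C) (x : 'Z_N) :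
  (1 < N)%N -> N.-primitive_root z -> x != 0 -> Zp_char z x != 1.
Proof.
move=> N_gt1 prim_z; apply: contra => /eqP e; apply/eqP/val_inj => /=.
have : (N %| x)%N by rewrite (prim_order_dvd prim_z) -/(Zp_char z x) e.
have := ltn_ord x; rewrite {2}Zp_cast // => lt dv; apply/eqP.
by apply: contraTT dv => x0; rewrite gtnNdvd ?lt0n.
Qed.

(** The [N]-th roots of unity are the [z ^+ j], and for [j != 0] the powers of [z ^+ j] form a
    nontrivial character of ['Z_N], which displaces a third of the exponents. Sampling applies with
    both index sets equal to ['Z_N]. *)
Lemma exists_spectral_sample (C : numClosedFieldType) (p k L : nat) :
  prime p -> (p ^ k.+1 <= 2 ^ L)%N ->
  exists2 s : seq nat, size s = (8 * L)%N &
    forall w : C, w ^+ (p ^ k.+1) = 1 -> w != 1 ->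
      L%:R <= \sum_(i <- s) `|w ^+ i - 1| ^+ 2.
Proof.
move=> pr_p NL; set N := (p ^ k.+1)%N in NL *.
have N_gt1 : (1 < N)%N by rewrite -(expn0 p) ltn_exp2l ?prime_gt1.
have [z prim_z] := exists_prim_root_pfactor C k pr_p.
have zN : z ^+ N = 1 := prim_expr_order prim_z.
pose good (j i : 'Z_N) := 1 <= `|(z ^+ j) ^+ i - 1| ^+ 2 :> C.
have third j : j != 0 -> (#|'Z_N| <= 3 * #|[set i | good j i]|)%N.
  move=> j0; have wN : (z ^+ j) ^+ N = 1 by rewrite exprAC zN expr1n.
  apply: (@card_le3_chi_displaced _ _ (Zp_char (z ^+ j)) _ _ (1%R : 'Z_N)).
  - by move=> x y; rewrite -Zp_charD.
  - by move=> x; apply: norm_Zp_char.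
  - by rewrite /Zp_char /= expr1 Zp_char_neq1.
have [||s ss hit] := @exists_sampling _ _ good (predC1 0) L third.
- by rewrite card_ord.
- by rewrite card_ord Zp_cast.
exists [seq val i | i <- s] => [|w wN w1]; first by rewrite size_map.
have [j w_j] := prim_rootP prim_z wN.
have jZ : (j < (Zp_trunc N).+2)%N by rewrite Zp_cast ?ltn_ord.
have {}w_j : w = z ^+ (Ordinal jZ : 'Z_N) by [].
have j0 : Ordinal jZ != 0 :> 'Z_N.
  by apply: contraNneq w1 => e; rewrite w_j e.
have := hit _ j0; rewrite -(ler_nat C) big_map => /le_trans; apply.
rewrite -sum1_count natr_sum big_mkcond; apply: ler_sum => i _ /=.
by rewrite w_j; case: ifP => // _; rewrite exprn_ge0.
Qed.

(** * Duality for cyclic groups and for the group algebra *)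

Section CyclicDuality.
Variables (C : numClosedFieldType) (N : nat) (z : C).
Hypotheses (N_gt1 : (1 < N)%N) (prim_z : N.-primitive_root z).

Definition cyclic_char (j x : 'Z_N) : C := Zp_char z (j * x).

Let zN : z ^+ N = 1 := prim_expr_order prim_z.

Lemma cyclic_charM j : {morph cyclic_char j : x y / (x * y)%g >-> x * y}.
Proof. by move=> x y; rewrite /cyclic_char -Zp_charD // -mulrDr. Qed.

Lemma norm_cyclic_char j x : `|cyclic_char j x| = 1.
Proof. exact: norm_Zp_char. Qed.

Lemma sum_cyclic_char x :
  \sum_j cyclic_char j x = (x == 1%g)%:R * #|'Z_N|%:R.
Proof.
rewrite /cyclic_char -[1%g]/(0 : 'Z_N); have [->|x0] := eqVneq x 0.
  by under eq_bigr do rewrite mulr0 Zp_char0; rewrite sumr_const mul1r.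
rewrite mul0r; apply: (@sum_chi_eq0 _ _ (fun j : 'Z_N => Zp_char z (j * x)) _ (1%R : 'Z_N)).
- by move=> i j; rewrite -Zp_charD // -mulrDl.
- by rewrite mul1r Zp_char_neq1.
Qed.

Lemma cyclic_char_sep i j : i != j -> exists x, cyclic_char i x != cyclic_char j x.
Proof.
move=> neq; exists 1; rewrite /cyclic_char !mulr1.
have := Zp_char_neq1 N_gt1 prim_z (_ : i - j != 0); rewrite subr_eq0 => /(_ neq).
apply: contra => /eqP e; apply/eqP; have nz := norm_Zp_char N_gt1 zN j.
have nj : Zp_char z j != 0 by rewrite -normr_eq0 nz oner_eq0.
by apply: (mulIf nj); rewrite -Zp_charD // subrK mul1r.
Qed.

End CyclicDuality.

Section GroupAlgebraDuality.
Variables (C : numClosedFieldType) (p : nat) (z : C).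
Hypotheses (pr_p : prime p) (prim_z : p.-primitive_root z).

Definition alg_char (f a : group_alg 'F_p 'Z_p) : C := z ^+ pairing f a.

(** Restated with [pdiv p] so that the lemmas on [Zp_char] apply to ['F_p], which unfolds to
    ['Z_(pdiv p)]. *)
Let prim_pdiv : (pdiv p).-primitive_root z.
Proof. by rewrite pdiv_id. Qed.

Let zN : z ^+ pdiv p = 1 := prim_expr_order prim_pdiv.

Let pdiv_gt1 : (1 < pdiv p)%N. Proof. by rewrite pdiv_id ?prime_gt1. Qed.

Lemma pairingDl (f g a : group_alg 'F_p 'Z_p) :
  pairing (f + g) a = pairing f a + pairing g a.
Proof. by rewrite -big_split; apply: eq_bigr => x _; rewrite ffunE mulrDl. Qed.

Lemma pairingDr (f a b : group_alg 'F_p 'Z_p) :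
  pairing f (a + b) = pairing f a + pairing f b.
Proof. by rewrite -big_split; apply: eq_bigr => x _; rewrite ffunE mulrDr. Qed.

Definition alg_delta x : group_alg 'F_p 'Z_p := [ffun y => (y == x)%:R].

Lemma pairing_delta (f : group_alg 'F_p 'Z_p) x : pairing f (alg_delta x) = f x.
Proof.
rewrite /pairing (bigD1 x) //= ffunE eqxx mulr1 big1 ?addr0 // => y ne.
by rewrite ffunE (negbTE ne) mulr0.
Qed.

Lemma pairingC (f g : group_alg 'F_p 'Z_p) : pairing f g = pairing g f.
Proof. by apply: eq_bigr => x _; rewrite mulrC. Qed.

Lemma alg_charM f : {morph alg_char f : x y / (x * y)%g >-> x * y}.
Proof.
by move=> x y; rewrite /alg_char pairingDr -/(Zp_char z _) (Zp_charD pdiv_gt1 zN).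
Qed.

Lemma norm_alg_char f x : `|alg_char f x| = 1.
Proof. exact: (norm_Zp_char pdiv_gt1 zN). Qed.

Lemma alg_char_neq1 f a : pairing f a != 0 -> alg_char f a != 1.
Proof. exact: (Zp_char_neq1 pdiv_gt1 prim_pdiv). Qed.

(** For fixed [a != 0] the summand is a character in [f], nontrivial at [alg_delta x] as soon as
    [a x != 0]. *)
Lemma sum_alg_char a :
  \sum_f alg_char f a = (a == 1%g)%:R * #|{: group_alg 'F_p 'Z_p}|%:R.
Proof.
rewrite -[1%g]/(0 : group_alg 'F_p 'Z_p); have [->|a0] := eqVneq a 0.
  rewrite mul1r -sumr_const; apply: eq_bigr => f _; rewrite /alg_char /pairing big1 //.
  by move=> x _; rewrite ffunE mulr0.
have [x ax] : exists x, a x != 0.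
  apply/existsP; apply: contraNT a0; rewrite negb_exists => /forallP h.
  by apply/eqP/ffunP => x; rewrite ffunE; apply/eqP; rewrite -[_ == _]negbK h.
rewrite mul0r; apply: (@sum_chi_eq0 _ _ (fun f => alg_char f a) _ (alg_delta x)).
- by move=> f g; rewrite /alg_char pairingDl -/(Zp_char z _) (Zp_charD pdiv_gt1 zN).
- by rewrite alg_char_neq1 // pairingC pairing_delta.
Qed.

Lemma alg_char_sep f g : f != g -> exists a, alg_char f a != alg_char g a.
Proof.
move=> neq; have [x fgx] : exists x, f x != g x.
  apply/existsP; apply: contraNT neq; rewrite negb_exists => /forallP h.
  by apply/eqP/ffunP => x; apply/eqP; rewrite -[_ == _]negbK h.
exists (alg_delta x); rewrite /alg_char !pairing_delta -!/(Zp_char z _).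
have := Zp_char_neq1 pdiv_gt1 prim_pdiv (_ : f x - g x != 0).
rewrite subr_eq0 => /(_ fgx).
apply: contra => /eqP e; apply/eqP; have nz := norm_Zp_char pdiv_gt1 zN (g x).
have nj : Zp_char z (g x) != 0 by rewrite -normr_eq0 nz oner_eq0.
by apply: (mulIf nj); rewrite -(Zp_charD pdiv_gt1 zN) subrK mul1r.
Qed.

End GroupAlgebraDuality.

(** * Structure of the extension *)

Lemma group_alg_expg p (a : group_alg 'F_p 'Z_p) k x :
  (a ^+ k)%g x = a x *+ k.
Proof.
elim: k => [|k IH]; first by rewrite expg0 ffunE mulr0n.
by rewrite expgS mulrS -IH; apply: ffunE.
Qed.

(** The element [c] lifts the generator of the quotient. The extension need not split, but
    [c ^ (p ^ n)] lies in the kernel, which has exponent [p]; hence the exponent [n.+1]. *)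
Lemma extension_generators (p n : nat) (gT : finGroupType) (G : {group gT}) :
  prime p -> (0 < n)%N -> is_extension (@ltrans_modp p n) G ->
  exists (iota : group_alg 'F_p 'Z_p -> gT) (c : gT),
    [/\ {morph iota : a b / (a * b)%g}, forall a, iota a \in G, c \in G,
        (c ^+ (p ^ n.+1))%g = 1%g &
        (forall (x : 'Z_p) a, iota a ^ (c ^+ x)^-1 = iota (ltrans x a))%g /\
        (forall g, g \in G -> exists a k, g = iota a * c ^+ k)%g].
Proof.
move=> pr_p n0 [A [iota [pi [nAG]]]].
have p_gt1 := prime_gt1 pr_p.
have pn_gt1 : (1 < p ^ n)%N by rewrite -(expn0 p) ltn_exp2l.
case/misomP => iM /isomP[_ iA] /misomP[pM /isomP[pinj pG]] conj.
have iotaM : {morph iota : a b / (a * b)%g}.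
  by move=> a b; have := morphM (morphm_morphism iM) (finset.in_setT a) (finset.in_setT b).
have iota_im g : g \in A -> exists a, g = iota a.
  by rewrite -iA => /morphimP[a _ _ ->]; exists a.
have iotaA a : iota a \in A by rewrite -iA -[iota a]/(morphm iM a) mem_morphim ?inE.
have sAG : A \subset G := normal_sub nAG.
have piM : {in (G / A)%g &, {morph pi : x y / (x * y)%g}}.
  by move=> x y Gx Gy; have := morphM (morphm_morphism pM) Gx Gy.
have NA g : g \in G -> g \in 'N(A)%g by apply/fintype.subsetP/normal_norm.
have cosetG g : g \in G -> coset A g \in (G / A)%g by move=> Gg; rewrite mem_quotient.
have [c Gc pc] : exists2 c, c \in G & pi (coset A c) = 1%R.
  have : (1%R : 'Z_(p ^ n)) \in [set: 'Z_(p ^ n)]%SET by rewrite inE.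
  rewrite -pG => /morphimP[y _ Gy e]; have /morphimP[c Nc Gc yc] := Gy.
  by exists c => //; rewrite e yc.
have pcX k : pi (coset A (c ^+ k)%g) = k%:R.
  elim: k => [|k IH].
    by rewrite expg0 morph1; have := morph1 (morphm_morphism pM).
  rewrite expgSr morphM ?NA ?groupX // piM ?cosetG ?groupX // IH pc.
  by rewrite -[LHS]/(_ + _) -natr1.
have kerA g k : g \in G -> pi (coset A g) = k%:R -> (g * c ^- k)%g \in A.
  move=> Gg e; have : coset A g = coset A (c ^+ k)%g.
    apply: (injmP pinj); rewrite ?cosetG ?groupX //=.
    by rewrite !morphmE e pcX.
  move/(rcoset_kercosetP (NA _ Gg) (NA _ (groupX k Gc))).
  by case/rcosetP => a Aa ->; rewrite mulgK.
exists iota, c; split=> //.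
- by move=> a; rewrite (fintype.subsetP sAG).
- have /iota_im[a e] : (c ^+ (p ^ n))%g \in A.
    have := @kerA (c ^+ (p ^ n))%g 0 (groupX _ Gc).
    rewrite pcX expg0 invg1 mulg1; apply.
    by apply/val_inj; rewrite /= Zp_nat /= Zp_cast ?modnn.
  rewrite expnSr expgM e.
  have iota1 : iota 1%g = 1%g by apply: (mulgI (iota 1%g)); rewrite -iotaM !mulg1.
  have iotaX k b : iota (b ^+ k)%g = (iota b ^+ k)%g.
    by elim: k => // k IH; rewrite !expgS iotaM IH.
  rewrite -iotaX -[RHS]iota1; congr iota; apply/ffunP => x.
  by rewrite group_alg_expg ffunE -mulr_natr pchar_Fp_0 ?mulr0.
- split=> [x a|g Gg].
    rewrite conj ?groupX // pcX; congr (iota (ltrans _ a)); apply/val_inj.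
    (* Since [n] is positive, [x < p <= p ^ n], so the reductions modulo [p ^ n] and modulo [p] both
       leave [x] unchanged. *)
    have ltx : (x < p)%N by have := ltn_ord x; rewrite {2}Zp_cast.
    have ltxn : (x < (Zp_trunc (p ^ n)).+2)%N.
      by rewrite (Zp_cast pn_gt1) (leq_trans ltx) // -{1}(expn1 p) leq_exp2l.
    by rewrite /= Zp_nat /= !modn_small.
  have [a e] := iota_im _ (@kerA g (pi (coset A g)) Gg (esym (natr_Zp _))).
  by exists a, (pi (coset A g)); rewrite -e mulgKV.
Qed.

Lemma pairing_ltrans p (x : 'Z_p) (f a : group_alg 'F_p 'Z_p) :
  pairing (ltrans x f) (ltrans x a) = pairing f a.
Proof.
rewrite /pairing (reindex_inj (mulgI x)) /=; apply: eq_bigr => y _.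
by rewrite !ffunE mulKg.
Qed.

Lemma ltrans_bij p (x : 'Z_p) : bijective (@ltrans 'F_p 'Z_p x).
Proof.
by exists (ltrans x^-1%g) => f; apply/ffunP => y; rewrite !ffunE ?invgK ?mulKg ?mulKVg.
Qed.

Lemma dnormB_le (C : numClosedFieldType) (U : lmodType C)
    (dot : {dot U for conjC}) u v :
  dot (u - v) (u - v) <= 2 * dot u u + 2 * dot v v.
Proof.
rewrite -subr_ge0 (_ : _ - _ = dot (u + v) (u + v)) ?dnorm_ge0 //.
by rewrite dnormB dnormD; ring.
Qed.

(** * The spectral gap in a unitary representation of the extension *)

Section Gap.
Variables (C : numClosedFieldType) (U : lmodType C) (dot : {dot U for conjC}).
Variables (gT : finGroupType) (G : {group gT}) (rho : gT -> {linear U -> U}).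
Hypothesis rho1 : forall v, rho 1%g v = v.
Hypothesis rhoM : {in G &, forall g h v, rho (g * h)%g v = rho g (rho h v)}.
Hypothesis rhoU : {in G, forall g u v, dot (rho g u) (rho g v) = dot u v}.
Hypothesis no_inv : forall v, {in G, forall g, rho g v = v} -> v = 0.

Variables (p n : nat) (iota : group_alg 'F_p 'Z_p -> gT) (c : gT).
Hypothesis pr_p : prime p.
Hypothesis iotaM : {morph iota : a b / (a * b)%g}.
Hypothesis iotaG : forall a, iota a \in G.
Hypothesis cG : c \in G.
Hypothesis cN : (c ^+ (p ^ n.+1))%g = 1%g.
Hypothesis conj_iota :
  forall (x : 'Z_p) a, (iota a ^ (c ^+ x)^-1 = iota (ltrans x a))%g.
Hypothesis genG : forall g, g \in G -> exists a k, (g = iota a * c ^+ k)%g.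

Variables (L : nat) (s : seq nat).
Hypothesis sample : forall w : C, w ^+ (p ^ n.+1) = 1 -> w != 1 ->
  L%:R <= \sum_(k <- s) `|w ^+ k - 1| ^+ 2.

Let N_gt1 : (1 < p ^ n.+1)%N.
Proof. by rewrite -(expn0 p) ltn_exp2l ?prime_gt1. Qed.

Lemma cyclic_gap v : exists w,
  [/\ rho c w = w, dot v v = dot w w + dot (v - w) (v - w) &
      L%:R * dot (v - w) (v - w) <=
      \sum_(k <- s) dot (rho (c ^+ k)%g v - v) (rho (c ^+ k)%g v - v)].
Proof.
have [z prim_z] := exists_prim_root_pfactor C n pr_p.
set N := (p ^ n.+1)%N in prim_z; have N1 : (1 < N)%N := N_gt1.
(* The order of [c] may be a proper divisor of [N], yet its powers still define a representation of
   ['Z_N]. The witness [w] is the projection of [v] onto the trivial character. *)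
pose r (k : 'Z_N) := rho (c ^+ k)%g; pose chi := cyclic_char (N := N) z.
have chiM : forall j, {morph chi j : x y / (x * y)%g >-> x * y}.
  exact: cyclic_charM.
have chiN : forall j x, `|chi j x| = 1 by exact: norm_cyclic_char.
have chi_sum := sum_cyclic_char N1 prim_z.
have chi_sep := cyclic_char_sep N1 prim_z.
have r1 v' : r 1%g v' = v' by rewrite /r expg0 rho1.
have cNZ : (c ^+ (Zp_trunc N).+2)%g = 1%g by rewrite Zp_cast.
have rM (a b : 'Z_N) v' : r (a * b)%g v' = r a (r b v').
  by rewrite /r -rhoM ?groupX // -expgD /= expg_mod.
have rU a u v' : dot (r a u) (r a v') = dot u v' by rewrite /r rhoU ?groupX.
have rX k : r ((1%R : 'Z_N) ^+ k)%g = rho (c ^+ k)%g.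
  by rewrite /r Zp_expg mul1n /= expg_mod.
exists (isotypic chi r 0 v); split.
- have := act_isotypic chiM chiN rM 0 (1%R : 'Z_N) v.
  by rewrite /r expg1 /chi /cyclic_char mul0r Zp_char0 scale1r.
- rewrite (dnorm_sub_isotypic chiM chiN chi_sum chi_sep r1 rM rU).
  by rewrite (dnorm_isotypic chiM chiN chi_sum chi_sep r1 rM rU v) (bigD1 0).
rewrite (dnorm_sub_isotypic chiM chiN chi_sum chi_sep r1 rM rU).
under [X in _ <= X]eq_bigr do rewrite -rX.
have := spectral_sample_gap chiM chiN chi_sum chi_sep r1 rM rU (a := 1%R) v sample.
rewrite Zp_expg mul1n -/N => /(_ _); rewrite (eq_bigl (fun j => j != 0)).
  by apply; apply/val_inj; rewrite /= Zp_cast ?modnn.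
move=> j; rewrite /chi /cyclic_char mulr1; have [->|j0] := eqVneq j 0.
  by rewrite Zp_char0 eqxx.
by rewrite Zp_char_neq1.
Qed.

Variable z : C.
Hypothesis prim_z : p.-primitive_root z.

Let chi := alg_char (p := p) z.
Let chiM : forall f, {morph chi f : x y / (x * y)%g >-> x * y} := alg_charM pr_p prim_z.
Let chiN : forall f a, `|chi f a| = 1 := norm_alg_char pr_p prim_z.
Let chi_sum := sum_alg_char pr_p prim_z.
Let chi_sep := alg_char_sep pr_p prim_z.
Let r a := rho (iota a).

Let iota1 : iota 1%g = 1%g.
Proof. by apply: (mulgI (iota 1%g)); rewrite -iotaM !mulg1. Qed.

Let r1 v : r 1%g v = v. Proof. by rewrite /r iota1 rho1. Qed.
Let rM a b v : r (a * b)%g v = r a (r b v). Proof. by rewrite /r iotaM rhoM. Qed.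
Let rU a u v : dot (r a u) (r a v) = dot u v. Proof. by rewrite /r rhoU. Qed.

Let iso f v := isotypic chi r f v.

(** The mass that the spectral measure of [v] gives to the characters of the kernel that are
    nontrivial at [u]. *)
Definition energy (u : group_alg 'F_p 'Z_p) v :=
  \sum_(f | pairing f u != 0) dot (iso f v) (iso f v).

Lemma iota_expg a k : iota (a ^+ k)%g = (iota a ^+ k)%g.
Proof. by elim: k => [|k IH] //; rewrite !expgS iotaM IH. Qed.

Lemma energy_gap u v : L%:R * energy u v <=
  \sum_(k <- s) dot (rho (iota u ^+ k)%g v - v) (rho (iota u ^+ k)%g v - v).
Proof.
under [X in _ <= X]eq_bigr do rewrite -iota_expg.
have := spectral_sample_gap chiM chiN chi_sum chi_sep r1 rM rU (a := u) v sample.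
rewrite (eq_bigl (fun f => pairing f u != 0)); last first.
  move=> f; have [e|ne] := eqVneq (pairing f u) 0; last exact: alg_char_neq1.
  by rewrite /chi /alg_char e expr0 eqxx.
apply; apply/ffunP => x.
by rewrite group_alg_expg ffunE expnS mulrnA -[_ *+ p]mulr_natr pchar_Fp_0 // mulr0 mul0rn.
Qed.

(** Split each component of [w] along [v] and [v - w]; the components of [v - w] have total mass at
    most its squared norm. *)
Lemma energy_le u v w :
  energy u w <= 2 * energy u v + 2 * dot (v - w) (v - w).
Proof.
have le_dot : \sum_(f | pairing f u != 0)
    dot (iso f (v - w)) (iso f (v - w)) <= dot (v - w) (v - w).
  rewrite [leRHS](dnorm_isotypic chiM chiN chi_sum chi_sep r1 rM rU) -/iso.
  by rewrite [leRHS](bigID (fun f => pairing f u != 0)) /= lerDl sumr_ge0.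
apply: (@le_trans _ _ (2 * energy u v + 2 * \sum_(f | pairing f u != 0)
    dot (iso f (v - w)) (iso f (v - w)))).
  rewrite !mulr_sumr -big_split; apply: ler_sum => f _ /=.
  have -> : iso f w = iso f v - iso f (v - w).
    by rewrite /iso -isotypicB opprB addrC subrK.
  exact: dnormB_le.
by rewrite lerD2l ler_pM2l.
Qed.

Section Invariant.
Variable w : U.
Hypothesis cw : rho c w = w.

Let cXw k : rho (c ^+ k)%g w = w.
Proof. by elim: k => [|k IH]; rewrite ?expg0 ?rho1 // expgS rhoM ?groupX // IH. Qed.

(** Conjugation by [c] permutes the characters of the kernel by translation while [c] fixes [w], so
    the spectral measure of [w] is translation invariant. *)
Lemma isotypic_ltrans (x : 'Z_p) f :
  rho (c ^+ x)%g (iso f w) = iso (ltrans x f) w.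
Proof.
rewrite /iso /isotypic linearZ linear_sum /=; congr (_ *: _).
rewrite [RHS](reindex _ (onW_bij _ (ltrans_bij x))) /=; apply: eq_bigr => a _.
rewrite linearZ /= /chi /alg_char pairing_ltrans; congr (_ *: _).
rewrite /r -conj_iota -{2}(cXw x) -!rhoM ?groupX ?groupJ ?groupV ?groupX //.
by rewrite conjgE invgK -!mulgA mulVg mulg1.
Qed.

(** This component is fixed by the kernel, and by [c] because the zero function is its own
    translate; together they generate [G]. *)
Lemma isotypic0_invariant : iso 0 w = 0.
Proof.
have pairing0 a : pairing 0 a = 0.
  by rewrite /pairing big1 // => x _; rewrite ffunE mul0r.
have inv_iota a : rho (iota a) (iso 0 w) = iso 0 w.
  rewrite -[rho _]/(r a) /iso (act_isotypic chiM chiN rM).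
  by rewrite /chi /alg_char pairing0 scale1r.
have inv_c : rho c (iso 0 w) = iso 0 w.
  have := isotypic_ltrans 1%R 0; rewrite expg1 => ->; congr iso.
  by apply/ffunP => x; rewrite !ffunE.
apply: no_inv => g /genG[a [k ->]]; rewrite rhoM ?groupX //.
suff -> : rho (c ^+ k)%g (iso 0 w) = iso 0 w by rewrite inv_iota.
by elim: k => [|k IH]; rewrite ?expg0 ?rho1 // expgS rhoM ?groupX // IH.
Qed.

(** Sum the translation-invariant energy over all [x], then count for each [f] the translates that
    contribute. *)
Lemma energy_translates u : p%:R * energy u w =
  \sum_f dot (iso f w) (iso f w) *
         #|[set x : 'Z_p | pairing (ltrans x f) u != 0%R]|%:R.
Proof.
have E (x : 'Z_p) : energy u w = \sum_(f | pairing (ltrans x f) u != 0)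
    dot (iso f w) (iso f w).
  rewrite /energy (reindex _ (onW_bij _ (ltrans_bij x))) /=.
  by apply: eq_bigr => f _; rewrite -isotypic_ltrans rhoU ?groupX.
rewrite -[in LHS](card_Zp_prime pr_p) mulr_natl -sumr_const.
under eq_bigr => x _ do rewrite (E x).
rewrite (exchange_big_dep xpredT) //=; apply: eq_bigr => f _.
rewrite sumr_const mulr_natr; congr (_ *+ _).
by apply: eq_card => x; rewrite !inE.
Qed.

Lemma dnorm_le_energy : dot w w <=
  2 * (energy (coef_elt p 0) w + energy (coef_elt p p./2) w).
Proof.
have p0 : 0 < p%:R :> C by rewrite ltr0n prime_gt0.
rewrite -(ler_pM2l p0) mulrCA mulrDr !energy_translates -big_split /= mulr_sumr.
rewrite (dnorm_isotypic chiM chiN chi_sum chi_sep r1 rM rU) -/iso mulr_sumr.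
apply: ler_sum => f _; have [->|f0] := eqVneq f 0.
  by rewrite -/(iso 0 w) isotypic0_invariant linear0r !mul0r addr0 !mulr0.
rewrite -mulrDr mulrCA [leLHS]mulrC ler_wpM2l ?dnorm_ge0 //.
by rewrite -natrD -natrM ler_nat pairing_translates.
Qed.

End Invariant.

Lemma displacement_gap v :
  L%:R * dot v v <= 9 * \sum_(g <- [:: c; iota (coef_elt p 0); iota (coef_elt p p./2)])
    \sum_(k <- s) dot (rho (g ^+ k)%g v - v) (rho (g ^+ k)%g v - v).
Proof.
have [w [cw vw gap]] := cyclic_gap v.
have g0 := energy_gap (coef_elt p 0) v; have gh := energy_gap (coef_elt p p./2) v.
have e0 := energy_le (coef_elt p 0) v w; have eh := energy_le (coef_elt p p./2) v w.
have ew := dnorm_le_energy cw.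
set E0 := energy _ v in g0 e0; set Eh := energy _ v in gh eh.
set d := dot (v - w) _ in vw gap e0 eh.
have E_ge0 u : 0 <= energy u v by apply: sumr_ge0 => f _; apply: dnorm_ge0.
rewrite !big_cons big_nil addr0 !mulrDr.
apply: (@le_trans _ _ (L%:R * (9 * d + (9 * E0 + 9 * Eh)))).
  rewrite ler_wpM2l ?ler0n // vw.
  (* [dnorm_le_energy] followed by two uses of [energy_le] costs [2 * (2 + 2) = 8] times [d]; the
     [d] in [vw] raises it to 9. *)
  have : dot w w <= 4 * E0 + 4 * Eh + 8 * d.
    apply: (le_trans ew); rewrite -subr_ge0.
    rewrite (_ : _ - _ = 2 * (2 * E0 + 2 * d - energy (coef_elt p 0) w) +
      2 * (2 * Eh + 2 * d - energy (coef_elt p p./2) w)); last by ring.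
    by rewrite addr_ge0 // mulr_ge0 // subr_ge0.
  rewrite -subr_ge0 => h; rewrite -subr_ge0.
  rewrite (_ : _ - _ = (4 * E0 + 4 * Eh + 8 * d - dot w w) + (5 * E0 + 5 * Eh)); last by ring.
  by rewrite addr_ge0 // addr_ge0 // mulr_ge0 // E_ge0.
rewrite !mulrDr !(mulrCA L%:R); apply: lerD; first by rewrite ler_pM2l.
by apply: lerD; rewrite ler_pM2l.
Qed.

End Gap.

(** * The generating multiset and the final constants *)

Lemma generated_by_powers (p : nat) (gT : finGroupType) (G : {group gT})
    (iota : group_alg 'F_p 'Z_p -> gT) (c : gT) (T : seq gT) :
  prime p ->
  {morph iota : a b / (a * b)%g} ->
  (forall (x : 'Z_p) a, iota a ^ (c ^+ x)^-1 = iota (ltrans x a))%g ->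
  (forall g, g \in G -> exists a k, g = iota a * c ^+ k)%g ->
  c \in T -> iota (coef_elt p 0) \in T -> {subset T <= G} ->
  <<[set x in T]%SET>>%g = G.
Proof.
move=> pr_p iotaM conj_iota genG Tc Tu TG; apply/eqP; rewrite finset.eqEsubset.
rewrite gen_subG; apply/andP; split.
  by apply/fintype.subsetP => x; rewrite inE; apply: TG.
set K := <<_>>%g; have Kc : c \in K by rewrite mem_gen ?inE.
suff Kiota a : iota a \in K.
  by apply/fintype.subsetP => g /genG[a [k ->]]; rewrite groupM ?groupX.
have iota1 : iota 1%g = 1%g by apply: (mulgI (iota 1%g)); rewrite -iotaM !mulg1.
(* Expansion in the basis of translates of the identity, each being a conjugate of
   [iota (coef_elt p 0)] by a power of [c]. *)
have -> : a = \sum_x ltrans x (coef_elt p 0) *+ (a x : nat).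
  apply/ffunP => y; rewrite sum_ffunE (bigD1 y) //= ffunMnE ffunE mulVg.
  rewrite (coef_elt0 pr_p) eqxx natr_Zp big1 ?addr0 // => x ne.
  rewrite ffunMnE ffunE (coef_elt0 pr_p) -[0]/(1%g : 'Z_p) -eq_mulVg1.
  by rewrite (negbTE ne) mul0rn.
elim/big_ind: _ => [|a1 a2 K1 K2|x _]; first by rewrite iota1.
  by rewrite iotaM groupM.
have Kx : iota (ltrans x (coef_elt p 0)) \in K.
  by rewrite -conj_iota groupJ ?groupV ?groupX // mem_gen ?inE.
by elim: (nat_of_ord _) => [|k IH]; rewrite ?mulr0n ?iota1 // mulrS iotaM groupM.
Qed.

(** Three elements with [8 * L + 1] exponents each give at most [27 * L] powers, as [L] is positive.
    With the factor 9 of [displacement_gap] the constant is [1 / (27 * 9)]. *)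
Lemma exists_kazhdan_multiset (R : realType) (p n L : nat)
    (gT : finGroupType) (G : {group gT}) :
  prime p -> (0 < n)%N -> (p ^ n.+1 <= 2 ^ L)%N ->
  is_extension (@ltrans_modp p n) G ->
  g_attained (243%:R^-1 : R) G (27 * L)%N.
Proof.
move=> pr_p n0 NL.
move=> /(extension_generators pr_p n0)[iota [c [iotaM iotaG cG cN [conj_iota genG]]]].
have L0 : (0 < L)%N.
  case: L NL => // ; rewrite expn0 leqNgt -{1}(expn0 p) ltn_exp2l //.
  exact: prime_gt1.
have [s ss sample] := exists_spectral_sample R[i] pr_p NL.
(* Adding the exponent 1 puts the three elements themselves into [T], so that it generates; the
   extra term is nonnegative. *)
have {}sample w : w ^+ (p ^ n.+1) = 1 -> w != 1 ->
    L%:R <= \sum_(k <- 1%N :: s) `|w ^+ k - 1| ^+ 2 :> R[i].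
  move=> wN w1; rewrite big_cons; apply: le_trans (sample w wN w1) _.
  by rewrite lerDr exprn_ge0.
have [z] := exists_prim_root_pfactor R[i] 0 pr_p; rewrite expn1 => prim_z.
pose gens := [:: c; iota (coef_elt p 0); iota (coef_elt p p./2)].
pose T := [seq (g ^+ k)%g | g <- gens, k <- 1%N :: s].
have sizeT : size T = (3 * (8 * L).+1)%N by rewrite size_allpairs /= ss.
exists T; split.
- apply: (generated_by_powers pr_p iotaM conj_iota genG).
  + by apply/allpairsP; exists (c, 1%N); rewrite /= !inE !eqxx.
  + by apply/allpairsP; exists (iota (coef_elt p 0), 1%N); rewrite /= !inE !eqxx orbT.
  move=> _ /allpairsP[[g k] /= [gin _ ->]]; rewrite groupX //.
  by move: gin; rewrite !inE => /or3P[] /eqP ->.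
- by rewrite sizeT; lia.
rewrite /is_avg_kazhdan; apply: le_ereal_inf_tmp => _ [rho no_inv ->].
apply: le_ereal_inf_tmp => _ [v /= v0 <-]; rewrite lee_fin /avg_displacement.
(* The order on [R[i]] compares real parts, so the bound may be proved before taking
   [complex.Re]. *)
suff : real_complex R 243%:R^-1 <= (size T)%:R^-1 *
    \sum_(t <- T) (`|ur_act rho t v - v| ^+ 2 / `|v| ^+ 2).
  by rewrite lecE => /andP[].
rewrite fmorphV rmorph_nat -mulr_suml ur_normE.
under eq_bigr do rewrite ur_normE.
have gap := displacement_gap (@ur_act1 _ _ _ rho) (@ur_actM _ _ _ rho)
  (@ur_actU _ _ _ rho) no_inv pr_p iotaM iotaG cG cN conj_iota genG sample prim_z v.
have d0 : 0 < ur_dot rho v v by rewrite dnorm_gt0.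
have t0 : 0 < (size T)%:R :> R[i] by rewrite ltr0n sizeT.
rewrite mulrA ler_pdivlMr // ler_pdivlMl // mulrCA ler_pdivrMl ?ltr0n //.
rewrite sizeT big_allpairs_dep.
apply: (@le_trans _ _ ((27 * L)%:R * ur_dot rho v v)).
  by rewrite ler_pM2r // ler_nat; lia.
rewrite natrM -mulrA (_ : 243%:R = 27%:R * 9%:R); last by rewrite -natrM.
by rewrite -mulrA ler_pM2l ?ltr0n.
Qed.

Lemma is_g_le (R : realType) (eps : R) (gT : finGroupType) (G : {group gT}) M :
  g_attained eps G M -> exists2 N, is_g eps G N & (N <= M)%N.
Proof.
move=> attM; have ex : exists N, `[< g_attained eps G N >] by exists M; apply/asboolP.
exists (ex_minn ex); last by case: ex_minnP => N _; apply; apply/asboolP.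
by case: ex_minnP => N /asboolP attN minN; split=> // K attK; apply/minN/asboolP.
Qed.

(** The rounded-up logarithm exceeds the true one by less than 1, and [ln 2 <= ln p]; the factor 2
    absorbs both terms. *)
Lemma up_log2_le_ln (R : realType) p : (1 < p)%N ->
  (up_log 2 p)%:R * ln 2%:R <= 2%:R * ln p%:R :> R.
Proof.
move=> p1; have := up_log_gtn (isT : 1 < 2)%N p1.
have : (0 < up_log 2 p)%N by rewrite up_log_gt0.
case: (up_log 2 p) => // k _ /= lt; have ln2p : ln 2%:R <= ln p%:R :> R.
  by rewrite ler_ln ?posrE ?ltr0n ?ler_nat // ltnW.
have : ln (2%:R ^+ k) <= ln p%:R :> R.
  by rewrite ler_ln ?posrE ?exprn_gt0 ?ltr0n ?(ltnW p1) // -natrX ler_nat ltnW.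
by rewrite lnXn ?ltr0n // -mulr_natl -[k.+1%:R]natr1 mulrDl mul1r; lra.
Qed.

Theorem corollary1p7 (R : realType) :
  exists eps C : R,
    [/\ 0 < eps, eps < 1, 0 < C &
      forall (n p : nat), (1 <= n)%N -> prime p ->
      forall (gT : finGroupType) (Gamma : {group gT}),
        is_extension (@ltrans_modp p n) Gamma ->
        exists2 N : nat, is_g eps Gamma N & N%:R <= C * n%:R * ln (p%:R : R)].
Proof.
have ln2 : 0 < ln 2%:R :> R by rewrite ln_gt0 // ltr1n.
(* The size is at most [27 * (n + 1) * up_log 2 p]; replacing [n + 1] by [2 * n] and the logarithm
   by [2 * ln p / ln 2] gives [27 * 4 = 108]. *)
exists 243%:R^-1, (108%:R / ln 2%:R); split.
- by rewrite invr_gt0 ltr0n.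
- by rewrite invf_lt1 ?ltr1n ?ltr0n.
- by rewrite divr_gt0 ?ltr0n.
move=> n p n1 pr_p gT Gamma ext.
have NL : (p ^ n.+1 <= 2 ^ (up_log 2 p * n.+1))%N by rewrite expnM leq_exp2r // up_logP.
have [N gN leN] := is_g_le (exists_kazhdan_multiset R pr_p n1 NL ext).
exists N => //; apply: (@le_trans _ _ (27 * (up_log 2 p * n.+1))%:R); first by rewrite ler_nat.
have up := up_log2_le_ln R (prime_gt1 pr_p).
have lnp : 0 < ln p%:R :> R by rewrite ln_gt0 // ltr1n prime_gt1.
have -> : 108%:R / ln 2%:R * n%:R * ln p%:R =
    (54 * n)%:R * (2%:R * ln p%:R) / ln 2%:R :> R by rewrite natrM; ring.
rewrite ler_pdivlMr // (_ : (27 * _)%:R * _ =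
    (27 * n.+1)%:R * ((up_log 2 p)%:R * ln 2%:R)); last by rewrite !natrM; ring.
apply: ler_pM => //; first by rewrite mulr_ge0 // ltW.
by rewrite ler_nat; lia.
Qed.
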